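(* There exist an integer $k \geq 1$ and maximum speeds $v_1, \dots, v_k > 0$ for which the partition-based strategy is not optimal: for some $l > (v_1 + \dots + v_k)/2$ there is a strategy for $k$ agents with maximum speeds $v_1, \dots, v_k$ that patrols the fence $[0, l]$.
   Context: Fence patrolling: a fence is a segment $[0,l]$ with $l>0$. There are $k$ agents $a_1,\dots,a_k$ with given maximum speeds $v_1,\dots,v_k>0$. The motion of agent $a_i$ is a function $a_i\colon[0,\infty)\to[0,l]$ satisfying $|a_i(t)-a_i(t+\epsilon)|\le v_i\epsilon$ for all $t\ge 0$, $\epsilon>0$. Agents may move in both directions and may pass each other. A strategy is a $k$-tuple $(a_1,\dots,a_k)$ of such functions. Agent $a_i$ covers the pair $(x;t^* )$ if $a_i(t)=x$ for some $t\in[t^*-1,t^* )$. A strategy patrols $[0,l]$ if for every $x\in[0,l]$ and every $t^*\in[1,\infty)$ some agent $a_i$ covers $(x;t^* )$. The partition-based strategy splits $[0,l]$ into $k$ consecutive segments of lengths proportional to $v_1,\dots,v_k$, with agent $a_i$ moving back and forth at full speed between the endpoints of the $i$-th segment; it patrols a fence of length $(v_1+\dots+v_k)/2$. It is called optimal for given speeds if no strategy for those speeds patrols a fence longer than $(v_1+\dots+v_k)/2$. *)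

(* Defs.v *)
From Stdlib Require Import Reals.
Open Scope R_scope.

Fixpoint speed_sum (v : nat -> R) (k : nat) : R :=
  match k with
  | O => 0
  | S k' => speed_sum v k' + v k'
  end.

(* A motion of an agent with maximum speed vi on the fence [0,l]:
   a function on [0,oo) (we use R -> R and only look at t >= 0)
   with values in [0,l] and |a t - a (t+eps)| <= vi * eps. *)
Definition motion (l vi : R) (a : R -> R) : Prop :=
  (forall t, 0 <= t -> 0 <= a t <= l) /\
  (forall t eps, 0 <= t -> 0 < eps -> Rabs (a t - a (t + eps)) <= vi * eps).

Definition strategy (l : R) (k : nat) (v : nat -> R) (a : nat -> R -> R) : Prop :=
  forall i, (i < k)%nat -> motion l (v i) (a i).

Definition covers (a : R -> R) (x tstar : R) : Prop :=
  exists t, tstar - 1 <= t < tstar /\ a t = x.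

Definition patrols (l : R) (k : nat) (a : nat -> R -> R) : Prop :=
  forall x tstar, 0 <= x <= l -> 1 <= tstar ->
    exists i, (i < k)%nat /\ covers (a i) x tstar.

(* Main.v *)
Require Import Defs.
From Stdlib Require Import Reals ZArith Arith Lia Lra.
Open Scope R_scope.

(** Take six agents of speed 1 and three of speed 1/5, and [l = 10/3 > 33/10].
    Cut the fence into two blocks of length 5/3.  In each block three fast
    agents sweep the whole block back and forth (period 10/3), one time unit
    apart.  The rightward sweeps leave a position at distance [s] from the left
    end of the block uncovered only for times in [(s + 3, s + 10/3]] modulo 10/3,
    and the leftward ones only for times in [(3 - s, 10/3 - s]].  These windows
    overlap only within 1/6 of a block end, and the overlaps at the two ends
    are half a period apart.  Hence a single agent of speed 1/5 zigzagging with
    the same period across a block end covers the missing pairs on both sides. *)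

(** * The triangle wave of period [p] *)

Definition nearest (p t : R) : Z := Int_part (t / p + 1 / 2).

(** Distance from [t] to the multiples of [p]: the position of an agent bouncing at unit speed on a
    segment of length [p / 2]. *)
Definition wave (p t : R) : R := Rabs (t - p * IZR (nearest p t)).

Lemma Int_part_bounds (r : R) : IZR (Int_part r) <= r < IZR (Int_part r) + 1.
Proof. destruct (base_Int_part r); lra. Qed.

Lemma wave_bounds (p t : R) : 0 < p -> 0 <= wave p t <= p / 2.
Proof.
  intros hp; split; [apply Rabs_pos|].
  unfold wave, nearest; set (n := IZR _).
  assert (hn : n <= t / p + 1 / 2 < n + 1) by apply Int_part_bounds.
  assert (ht : t = p * (t / p)) by (field; lra).
  set (q := t / p) in *.
  apply Rabs_le; rewrite ht; nra.
Qed.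

(** Rounding leaves [t] within [p / 2] of its chosen multiple, and distinct multiples are at least
    [p] apart, so any other one is at least [p / 2] away. *)
Lemma wave_le_dist (p t : R) (m : Z) :
  0 < p -> wave p t <= Rabs (t - p * IZR m).
Proof.
  intros hp.
  pose proof (wave_bounds p t hp) as hw; unfold wave in *.
  set (n := nearest p t) in *.
  destruct (Z.lt_trichotomy n m) as [h | [-> | h]]; [| lra |].
  - assert (IZR n + 1 <= IZR m) by (rewrite <- plus_IZR; apply IZR_le; lia).
    revert hw; unfold Rabs; repeat destruct Rcase_abs; nra.
  - assert (IZR m + 1 <= IZR n) by (rewrite <- plus_IZR; apply IZR_le; lia).
    revert hw; unfold Rabs; repeat destruct Rcase_abs; nra.
Qed.

(** As for any distance to a set: each point is compared with the multiple nearest to the other. *)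
Lemma wave_lipschitz (p s t : R) :
  0 < p -> Rabs (wave p s - wave p t) <= Rabs (s - t).
Proof.
  intros hp.
  pose proof (wave_le_dist p s (nearest p t) hp) as hs.
  pose proof (wave_le_dist p t (nearest p s) hp) as ht.
  unfold wave in *.
  revert hs ht; unfold Rabs; repeat destruct Rcase_abs; lra.
Qed.

(** Allows evaluating the wave without computing [nearest]; at a tie both neighbouring multiples
    give the same distance. *)
Lemma wave_of_dist (p t : R) (m : Z) :
  0 < p -> Rabs (t - p * IZR m) <= p / 2 -> wave p t = Rabs (t - p * IZR m).
Proof.
  intros hp hm.
  pose proof (wave_le_dist p t m hp) as hle.
  pose proof (wave_bounds p t hp) as hw; unfold wave in *.
  set (n := nearest p t) in *.
  destruct (Z.lt_trichotomy n m) as [h | [-> | h]]; [| reflexivity |].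
  - assert (IZR n + 1 <= IZR m) by (rewrite <- plus_IZR; apply IZR_le; lia).
    revert hw hm hle; unfold Rabs; repeat destruct Rcase_abs; nra.
  - assert (IZR m + 1 <= IZR n) by (rewrite <- plus_IZR; apply IZR_le; lia).
    revert hw hm hle; unfold Rabs; repeat destruct Rcase_abs; nra.
Qed.

Lemma wave_rising (p s : R) (m : Z) :
  0 < p -> 0 <= s <= p / 2 -> wave p (s + p * IZR m) = s.
Proof.
  intros hp hs.
  assert (h : Rabs (s + p * IZR m - p * IZR m) = s)
    by (rewrite Rabs_pos_eq; lra).
  rewrite (wave_of_dist p _ m hp); lra.
Qed.

Lemma wave_falling (p s : R) (m : Z) :
  0 < p -> 0 <= s <= p / 2 -> wave p (- s + p * IZR m) = s.
Proof.
  intros hp hs.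
  assert (h : Rabs (- s + p * IZR m - p * IZR m) = s)
    by (rewrite Rabs_left1; lra).
  rewrite (wave_of_dist p _ m hp); lra.
Qed.

(** The residue is open at 0 and closed at [p] because a visit at time [u] covers exactly the
    [tstar] with [u < tstar <= u + 1]. *)
Lemma exists_residue (p t : R) :
  0 < p -> exists m : Z, 0 < t - p * IZR m <= p.
Proof.
  (* This integer is the ceiling of [t / p], minus 1. *)
  intros hp; exists (- Int_part (- t / p) - 1)%Z.
  rewrite minus_IZR, opp_IZR.
  pose proof (Int_part_bounds (- t / p)) as hn.
  assert (ht : - t = p * (- t / p)) by (field; lra).
  set (q := - t / p) in *; nra.
Qed.

(** * Motions of the nine agents *)

(** The zigzags around the two fence ends would leave the fence by up to 1/6; projecting onto it
    respects the speed bound and fixes all positions inside. *)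
Definition clip (l y : R) : R := Rmax 0 (Rmin l y).

Lemma clip_bounds (l y : R) : 0 <= l -> 0 <= clip l y <= l.
Proof. unfold clip, Rmax, Rmin; repeat destruct Rle_dec; lra. Qed.

Lemma clip_id (l y : R) : 0 <= y <= l -> clip l y = y.
Proof. unfold clip, Rmax, Rmin; repeat destruct Rle_dec; lra. Qed.

Lemma clip_lipschitz (l y z : R) :
  0 <= l -> Rabs (clip l y - clip l z) <= Rabs (y - z).
Proof.
  unfold clip, Rmax, Rmin, Rabs.
  repeat destruct Rle_dec; repeat destruct Rcase_abs; lra.
Qed.

Definition fast_agent (b j : nat) (t : R) : R :=
  5 / 3 * INR b + wave (10 / 3) (t - INR j).

(* The phase 1/2 makes the zigzag start sweeping a side of the block end as
   early as the visits there become useful. *)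
Definition slow_agent (b : nat) (t : R) : R :=
  clip (10 / 3) (5 / 3 * INR b + (wave (10 / 3) (t - 1 / 2) - 5 / 6) / 5).

Definition agent_speed (i : nat) : R := if i <? 6 then 1 else 1 / 5.

Definition agent (i : nat) : R -> R :=
  if i <? 6 then fast_agent (i / 3) (i mod 3) else slow_agent (i - 6).

Lemma fast_agent_motion (b j : nat) :
  (b < 2)%nat -> motion (10 / 3) 1 (fast_agent b j).
Proof.
  intros hb; unfold fast_agent; split.
  - intros t _.
    pose proof (wave_bounds (10 / 3) (t - INR j)).
    assert (INR b <= 1) by (apply (le_INR b 1); lia).
    pose proof (pos_INR b); lra.
  - intros t eps _ heps.
    pose proof (wave_lipschitz (10 / 3) (t - INR j) (t + eps - INR j)) as h.
    revert h; unfold Rabs; repeat destruct Rcase_abs; lra.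
Qed.

Lemma slow_agent_motion (b : nat) : motion (10 / 3) (1 / 5) (slow_agent b).
Proof.
  unfold slow_agent; split.
  - intros t _; apply clip_bounds; lra.
  - intros t eps _ heps.
    eapply Rle_trans; [apply clip_lipschitz; lra|].
    pose proof (wave_lipschitz (10 / 3) (t - 1 / 2) (t + eps - 1 / 2)) as h.
    revert h; unfold Rabs; repeat destruct Rcase_abs; lra.
Qed.

Lemma agent_strategy : strategy (10 / 3) 9 agent_speed agent.
Proof.
  intros i hi; unfold agent, agent_speed.
  destruct (Nat.ltb_spec i 6).
  - apply fast_agent_motion, Nat.Div0.div_lt_upper_bound; lia.
  - apply slow_agent_motion.
Qed.

(** * Covering a block *)

(** Agent [j] passes [s] rightward at time [j + s] modulo the period; the unit windows after these
    three visits tile an interval of length 3. *)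
Lemma fast_agents_cover_rising (b : nat) (s tstar : R) (m : Z) :
  0 <= s <= 5 / 3 -> 0 < tstar - s - 10 / 3 * IZR m <= 3 ->
  exists j, (j < 3)%nat /\ covers (fast_agent b j) (5 / 3 * INR b + s) tstar.
Proof.
  intros hs ht.
  assert (hj : exists j, (j < 3)%nat /\
            INR j < tstar - s - 10 / 3 * IZR m <= INR j + 1).
  { destruct (Rle_dec (tstar - s - 10 / 3 * IZR m) 1);
      [exists 0%nat | destruct (Rle_dec (tstar - s - 10 / 3 * IZR m) 2);
        [exists 1%nat | exists 2%nat]]; (split; [lia | simpl; lra]). }
  destruct hj as (j & hj3 & hj); exists j; split; [exact hj3|].
  exists (INR j + (s + 10 / 3 * IZR m)); split; [lra|].
  unfold fast_agent.
  replace (INR j + (s + 10 / 3 * IZR m) - INR j)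
    with (s + 10 / 3 * IZR m) by ring.
  rewrite wave_rising; lra.
Qed.

Lemma fast_agents_cover_falling (b : nat) (s tstar : R) (m : Z) :
  0 <= s <= 5 / 3 -> 0 < tstar + s - 10 / 3 * IZR m <= 3 ->
  exists j, (j < 3)%nat /\ covers (fast_agent b j) (5 / 3 * INR b + s) tstar.
Proof.
  intros hs ht.
  assert (hj : exists j, (j < 3)%nat /\
            INR j < tstar + s - 10 / 3 * IZR m <= INR j + 1).
  { destruct (Rle_dec (tstar + s - 10 / 3 * IZR m) 1);
      [exists 0%nat | destruct (Rle_dec (tstar + s - 10 / 3 * IZR m) 2);
        [exists 1%nat | exists 2%nat]]; (split; [lia | simpl; lra]). }
  destruct hj as (j & hj3 & hj); exists j; split; [exact hj3|].
  exists (INR j + (- s + 10 / 3 * IZR m)); split; [lra|].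
  unfold fast_agent.
  replace (INR j + (- s + 10 / 3 * IZR m) - INR j)
    with (- s + 10 / 3 * IZR m) by ring.
  rewrite wave_falling; lra.
Qed.

Lemma slow_agent_covers_right (b : nat) (s tstar : R) (m : Z) :
  0 <= s <= 1 / 6 -> 0 <= 5 / 3 * INR b + s <= 10 / 3 ->
  3 + s < tstar - 10 / 3 * IZR m <= 10 / 3 - s ->
  covers (slow_agent b) (5 / 3 * INR b + s) tstar.
Proof.
  intros hs hx ht.
  (* The visit on the way back to the block end, reached at time 3. It is recent enough because
     [10 / 3 - s <= 4 - 5 * s] when [s <= 1 / 6]. *)
  exists (3 - 5 * s + 10 / 3 * IZR m); split; [lra|].
  unfold slow_agent.
  replace (3 - 5 * s + 10 / 3 * IZR m - 1 / 2)
    with (- (5 / 6 + 5 * s) + 10 / 3 * IZR (m + 1)) by (rewrite plus_IZR; lra).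
  rewrite wave_falling by lra.
  rewrite clip_id; lra.
Qed.

Lemma slow_agent_covers_left (b : nat) (s tstar : R) (m : Z) :
  0 <= s <= 1 / 6 -> 0 <= 5 / 3 * INR b - s <= 10 / 3 ->
  4 / 3 + s < tstar - 10 / 3 * IZR m <= 5 / 3 - s ->
  covers (slow_agent b) (5 / 3 * INR b - s) tstar.
Proof.
  intros hs hx ht.
  (* Half a period earlier, the mirror-image return to the block end from its left. *)
  exists (4 / 3 - 5 * s + 10 / 3 * IZR m); split; [lra|].
  unfold slow_agent.
  replace (4 / 3 - 5 * s + 10 / 3 * IZR m - 1 / 2)
    with (5 / 6 - 5 * s + 10 / 3 * IZR m) by lra.
  rewrite wave_rising by lra.
  rewrite clip_id; lra.
Qed.

Lemma block_covered (b : nat) (s tstar : R) :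
  (b < 2)%nat -> 0 <= s <= 5 / 3 ->
  (exists j, (j < 3)%nat /\
     covers (fast_agent b j) (5 / 3 * INR b + s) tstar) \/
  covers (slow_agent b) (5 / 3 * INR b + s) tstar \/
  covers (slow_agent (S b)) (5 / 3 * INR b + s) tstar.
Proof.
  intros hb hs.
  assert (hb1 : INR b <= 1) by (apply (le_INR b 1); lia).
  pose proof (pos_INR b) as hb0.
  destruct (exists_residue (10 / 3) (tstar - s)) as [m hm]; [lra|].
  destruct (exists_residue (10 / 3) (tstar + s)) as [n hn]; [lra|].
  destruct (Rle_dec (tstar - s - 10 / 3 * IZR m) 3) as [hm3|hm3].
  { left; apply (fast_agents_cover_rising b s tstar m); lra. }
  destruct (Rle_dec (tstar + s - 10 / 3 * IZR n) 3) as [hn3|hn3].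
  { left; apply (fast_agents_cover_falling b s tstar n); lra. }
  right.
  (* Both residues lie in [(3, 10 / 3]], so [2 * s] is within 1/3 of [10 / 3 * (n - m)]: either
     [s < 1 / 6] or [5 / 3 - s < 1 / 6]. *)
  assert (hmn : n = m \/ n = (m + 1)%Z).
  { assert (h1 : (m < n + 1)%Z) by (apply lt_IZR; rewrite plus_IZR; lra).
    assert (h2 : (n < m + 2)%Z) by (apply lt_IZR; rewrite plus_IZR; lra).
    lia. }
  destruct hmn as [-> | ->].
  - left; apply (slow_agent_covers_right b s tstar m); lra.
  - right; rewrite plus_IZR in *.
    replace (5 / 3 * INR b + s) with (5 / 3 * INR (S b) - (5 / 3 - s))
      by (rewrite S_INR; lra).
    apply (slow_agent_covers_left (S b) (5 / 3 - s) tstar (m + 1));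
      rewrite ?S_INR, ?plus_IZR; lra.
Qed.

(** * Assembling the strategy *)

Lemma agent_fast (b j : nat) :
  (b < 2)%nat -> (j < 3)%nat -> agent (b * 3 + j) = fast_agent b j.
Proof.
  intros hb hj; unfold agent.
  destruct (Nat.ltb_spec (b * 3 + j) 6); [|lia].
  rewrite Nat.div_add_l, Nat.div_small, Nat.add_0_r by lia.
  rewrite Nat.add_comm, Nat.Div0.mod_add, Nat.mod_small by lia.
  reflexivity.
Qed.

Lemma agent_slow (b : nat) : agent (6 + b) = slow_agent b.
Proof.
  unfold agent; destruct (Nat.ltb_spec (6 + b) 6); [lia|].
  now replace (6 + b - 6)%nat with b by lia.
Qed.

Lemma agent_patrols : patrols (10 / 3) 9 agent.
Proof.
  intros x tstar hx _.
  assert (hbs : exists b s,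
            (b < 2)%nat /\ 0 <= s <= 5 / 3 /\ x = 5 / 3 * INR b + s).
  { destruct (Rle_dec x (5 / 3)).
    - exists 0%nat, x; split; [lia | simpl; lra].
    - exists 1%nat, (x - 5 / 3); split; [lia | simpl; lra]. }
  destruct hbs as (b & s & hb & hs & ->).
  destruct (block_covered b s tstar hb hs) as [(j & hj & hc) | [hc | hc]].
  - exists (b * 3 + j)%nat; rewrite agent_fast by assumption.
    split; [lia | exact hc].
  - exists (6 + b)%nat; rewrite agent_slow; split; [lia | exact hc].
  - exists (6 + S b)%nat; rewrite agent_slow; split; [lia | exact hc].
Qed.

Theorem theorem1 :
  exists (k : nat) (v : nat -> R),
    (1 <= k)%nat /\ (forall i, (i < k)%nat -> 0 < v i) /\
    exists (l : R) (a : nat -> R -> R),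
      speed_sum v k / 2 < l /\ strategy l k v a /\ patrols l k a.
Proof.
  exists 9%nat, agent_speed; split; [lia|]; split.
  - intros i _; unfold agent_speed; destruct (i <? 6); lra.
  - exists (10 / 3), agent; split; [|split].
    + unfold agent_speed; simpl; lra.
    + exact agent_strategy.
    + exact agent_patrols.
Qed.
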